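(* For every integer $t\ge 0$ there is a constant $c_t$ such that every finite hypergraph $H$ whose hyperedges are all nonempty and whose twin-width is at most $t$ satisfies $\tau(H)\le c_t\,\mu(H)$.
   Context: For a hypergraph $H$ with vertex set $V(H)$ and hyperedge set $E(H)$ (a family of subsets of $V(H)$), $\mu(H)$ is the maximum number of pairwise disjoint hyperedges, and $\tau(H)$ is the minimum size of a set of vertices meeting every hyperedge. The incidence bipartite graph $B(H)$ has vertex set $V(H)\cup E(H)$, with $v\in V(H)$ adjacent to $e\in E(H)$ iff $v\in e$; the twin-width of $H$ is $\mathrm{tww}(B(H))$. A trigraph $K$ consists of a vertex set $V(K)$ and two disjoint sets of unordered pairs of distinct vertices: black edges $E(K)$ and red edges $R(K)$. Two vertices are adjacent (neighbors) if they are joined by a black or a red edge. The red graph of $K$ is $(V(K),R(K))$; $K$ is a $d$-trigraph if its red graph has maximum degree at most $d$. A graph is a trigraph with no red edges. Contracting two distinct vertices $u,v$ of a trigraph $K$ yields the trigraph obtained by deleting $u$ and $v$ and adding a new vertex $z$ such that, for every other vertex $x$: $zx$ is a black edge if both $ux$ and $vx$ are black edges; $zx$ is not an edge if $x$ is adjacent to neither $u$ nor $v$; and $zx$ is a red edge otherwise. All edges not incident to $u$ or $v$ are unchanged. A $d$-sequence of an $n$-vertex graph $G$ is a sequence of $d$-trigraphs $G=G_n,G_{n-1},\dots,G_1$ such that $G_1$ has a single vertex and each $G_{i-1}$ is obtained from $G_i$ by one contraction. The twin-width $\mathrm{tww}(G)$ of $G$ is the minimum $d$ such that $G$ admits a $d$-sequence.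 *)

(* Defs.v *)
From mathcomp Require Import all_boot.
Set Implicit Arguments. Unset Strict Implicit. Unset Printing Implicit Defensive.

(* A trigraph over a vertex universe U: a vertex set, and black / red edges.
   Unordered pairs {x,y} are stored as both ordered pairs (x,y) and (y,x). *)
Record trigraph (U : finType) := Trigraph {
  tV : {set U};
  tB : {set U * U};
  tR : {set U * U} }.

Section Trigraphs.
Variable U : finType.
Implicit Types (K : trigraph U) (x y u v z : U).

Definition black K x y := (x, y) \in tB K.
Definition red K x y := (x, y) \in tR K.
Definition tadj K x y := black K x y || red K x y.

(* Contraction of distinct vertices u, v of K into a new vertex z
   (z must not be one of the remaining vertices; the name of the new vertex is
   irrelevant, it may reuse the name u or v). *)
Definition contract K u v z : trigraph U :=
  let S := (tV K :\ u) :\ v in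
  let zB x := black K u x && black K v x in
  let zR x := tadj K u x || tadj K v x in
  let zRed x := zR x && ~~ zB x in
  Trigraph (z |: S)
    ([set p in tB K | (p.1 \in S) && (p.2 \in S)]
       :|: [set p | (p.1 == z) && (p.2 \in S) && zB p.2]
       :|: [set p | (p.2 == z) && (p.1 \in S) && zB p.1])
    ([set p in tR K | (p.1 \in S) && (p.2 \in S)]
       :|: [set p | (p.1 == z) && (p.2 \in S) && zRed p.2]
       :|: [set p | (p.2 == z) && (p.1 \in S) && zRed p.1]).

Definition contraction_step K K' : Prop :=
  exists u v z, [/\ u \in tV K, v \in tV K, u != v,
                    z \notin (tV K :\ u) :\ v & K' = contract K u v z].

Definition d_trigraph (d : nat) K : Prop :=
  forall x, x \in tV K -> #|[set y in tV K | red K x y]| <= d.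

End Trigraphs.

Definition graph_trigraph (T : finType) (adj : rel T) : trigraph T :=
  Trigraph [set: T] [set p | adj p.1 p.2] set0.

Definition d_sequence (T : finType) (adj : rel T) (d : nat)
    (s : seq (trigraph T)) : Prop :=
  let G := graph_trigraph adj in
  [/\ forall i, i < (size s).-1 -> contraction_step (nth G s i) (nth G s i.+1),
      head G s = G,
      size s > 0,
      #|tV (last G s)| = 1 &
      forall i, i < size s -> d_trigraph d (nth G s i)].

Definition has_d_sequence (T : finType) (adj : rel T) (d : nat) : Prop :=
  exists s, d_sequence adj d s.

Definition tww_le (T : finType) (adj : rel T) (t : nat) : Prop :=
  exists d, d <= t /\ has_d_sequence adj d.

Section Hypergraphs.
Variable V : finType.
Variable H : {set {set V}}.

Definition hedge := {e : {set V} | e \in H}.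

Definition incidence_adj : rel (V + hedge)%type :=
  fun a b => match a, b with
             | inl v, inr e => v \in val e
             | inr e, inl v => v \in val e
             | _, _ => false
             end.

Definition hyp_tww_le (t : nat) : Prop := tww_le incidence_adj t.

Definition pairwise_disjoint (F : {set {set V}}) : bool :=
  [forall e in F, forall f in F, (e != f) ==> [disjoint e & f]].

Definition mu : nat :=
  \max_(F : {set {set V}} | (F \subset H) && pairwise_disjoint F) #|F|.

Definition transversal (S : {set V}) : bool :=
  [forall e in H, ~~ [disjoint S & e]].

(* tau(H): minimum size of a vertex set meeting every hyperedge
   (the default #|V| is irrelevant when all hyperedges are nonempty,
   since then [set: V] is such a set) *)
Definition tau : nat :=
  \big[minn/#|V|]_(S : {set V} | transversal S) #|S|.

End Hypergraphs.

(* Main.v *)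
Require Import Defs.
From mathcomp Require Import all_boot.

Set Implicit Arguments. Unset Strict Implicit. Unset Printing Implicit Defensive.

(** Read the contraction sequence as a sequence of coarser and coarser partitions
    of [V + H].  A hyperedge is alive as long as its part has a black neighbour:
    any vertex of that neighbour then hits all hyperedges of the part.  Scan the
    sequence from fine to coarse, maintaining a packing [M] and a set [S] that hits
    every dead hyperedge and every hyperedge meeting a member of [M].  When an
    unhit hyperedge [e] dies, add it to [M].  Since [e] is dead, it lies in its own
    part and the at most [d] red neighbours of that part, so a hyperedge meeting [e]
    is dead, or lies in one of at most [(d + 1)^2] alive parts, or is black to one
    of at most [d + 1] parts; and the hyperedges that die in one contraction of [u]
    and [v] lie in, or are black to, [u] or [v].  Hence [S] grows by at most
    [4 + 2 (d + 1)^2] for each element of [M]. *)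

(** * Bounds on unions and minima, and disjointness of set families *)

Lemma card_bigcup_le (I T : finType) (A : {set I}) (F : I -> {set T}) m :
  (forall i, i \in A -> #|F i| <= m) -> #|\bigcup_(i in A) F i| <= #|A| * m.
Proof.
move=> Fm; rewrite -sum_nat_const.
elim/big_rec2: _ => [|i x B Ai le_xB]; first by rewrite cards0.
by apply: leq_trans (leq_card_setU _ _) _; rewrite leq_add ?Fm.
Qed.

Lemma bigminn_inf (I : finType) (P : pred I) (F : I -> nat) n0 i :
  P i -> \big[minn/n0]_(j | P j) F j <= F i.
Proof.
move=> Pi; elim: index_enum (mem_index_enum i) => // j r IHr.
rewrite inE big_cons => /orP[/eqP<-|/IHr le_i]; first by rewrite Pi geq_minl.
by case: (P j) => //; rewrite geq_min le_i orbT.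
Qed.

Lemma meets_subset (T : finType) (A B C : {set T}) :
  A \subset B -> ~~ [disjoint A & C] -> ~~ [disjoint B & C].
Proof. by move=> sAB; apply/contra/disjointWl. Qed.

Lemma pairwise_disjointP (V : finType) (F : {set {set V}}) :
  reflect (forall e f, e \in F -> f \in F -> e != f -> [disjoint e & f])
    (pairwise_disjoint F).
Proof.
apply: (iffP forall_inP) => [disF e f Fe Ff | disF e Fe].
  by apply/implyP; have /forall_inP-> := disF e Fe.
by apply/forall_inP => f Ff; apply/implyP; apply: disF.
Qed.

(** * Trigraphs as quotients of a graph, and their contractions *)

Section Quotient.

Variables (T : finType) (adj : rel T).
Hypothesis adjC : symmetric adj.

(* The parts of the partition are the fibres of [phi]; nothing is required inside a part. *)
Definition quotient_map (U : finType) (K : trigraph U) (phi : T -> U) : Prop :=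
  [/\ forall x, phi x \in tV K,
      forall x y, black K (phi x) (phi y) -> adj x y &
      forall x y, adj x y -> phi x = phi y \/ tadj K (phi x) (phi y)].

Definition merge (U : eqType) (u v z : U) (phi : T -> U) x :=
  if (phi x == u) || (phi x == v) then z else phi x.

Section Contract.

Variables (U : finType) (K : trigraph U) (phi : T -> U) (u v z : U).
Hypothesis Kphi : quotient_map K phi.
Hypothesis z_new : z \notin (tV K :\ u) :\ v.

Let S := (tV K :\ u) :\ v.

Lemma mergeP x :
  (merge u v z phi x = z /\ (phi x = u \/ phi x = v)) \/
  [/\ merge u v z phi x = phi x, phi x \in S, phi x != u, phi x != v & phi x != z].
Proof.
have [KV _ _] := Kphi; rewrite /merge.
case: eqP => [->|/eqP xu]; first by left; split; [|left].
case: eqP => [->|/eqP xv]; first by left; split; [|right].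
have xS: phi x \in S by rewrite !inE xu xv KV.
by right; split=> //; apply: contraNneq z_new => <-.
Qed.

Lemma black_contractE p q : black (contract K u v z) p q =
  [|| [&& black K p q, p \in S & q \in S],
      [&& p == z, q \in S, black K u q & black K v q] |
      [&& q == z, p \in S, black K u p & black K v p]].
Proof.
rewrite /black /contract /= -/S; move: S => A.
by rewrite !inE /= -!andbA -!orbA.
Qed.

Lemma red_contractE p q : red (contract K u v z) p q =
  [|| [&& red K p q, p \in S & q \in S],
      [&& p == z, q \in S, tadj K u q || tadj K v q & ~~ (black K u q && black K v q)] |
      [&& q == z, p \in S, tadj K u p || tadj K v p & ~~ (black K u p && black K v p)]].
Proof.
rewrite /red /contract /= -/S; move: S => A.
by rewrite !inE /= -!andbA -!orbA.
Qed.

(** A black edge at [z] comes from black edges at both [u] and [v], so it still joins its two parts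
    completely; an edge at just one of [u], [v] survives at [z] as red. *)
Lemma quotient_contract : quotient_map (contract K u v z) (merge u v z phi).
Proof.
have [KV Kb Ka] := Kphi; have zS : (z \in S) = false by apply/negbTE.
split.
- move=> x; case: (mergeP x) => [[-> _]|[-> xS _ _ _]] /=; first by rewrite setU11.
  by rewrite in_setU1 -/S xS orbT.
- move=> x y; rewrite black_contractE.
  case: (mergeP x) => [[-> xuv]|[-> xS xu xv xz]];
    case: (mergeP y) => [[-> yuv]|[-> yS yu yv yz]].
  (* Since [z] is outside [S], the contraction has no loop at [z]. *)
  + by rewrite zS !andbF.
  + rewrite zS (negPf yz) eqxx yS /= andbF orbF => /andP[uy vy].
    by case: xuv => E; apply: Kb; rewrite E.
  + rewrite zS (negPf xz) eqxx xS /= !andbF => /andP[ux vx].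
    by rewrite adjC; case: yuv => E; apply: Kb; rewrite E.
  + by rewrite (negPf xz) (negPf yz) !orbF => /andP[Kxy _]; apply: Kb.
have half x y : phi x = u \/ phi x = v -> phi y \in S -> adj x y ->
    tadj K u (phi y) || tadj K v (phi y).
  move=> xuv yS /Ka[exy|]; last by case: xuv => -> ->; rewrite ?orbT.
  by move: yS; rewrite -exy !inE; case: xuv => ->; rewrite eqxx ?andbF.
move=> x y xy; rewrite /tadj black_contractE red_contractE.
case: (mergeP x) => [[-> xuv]|[-> xS xu xv xz]];
  case: (mergeP y) => [[-> yuv]|[-> yS yu yv yz]].
- by left.
- right; rewrite (half x y) // eqxx yS zS /= !andbF /=.
  by case: (black K u _ && _); rewrite ?orbT.
- right; rewrite (half y x) 1?adjC // eqxx xS zS /= !andbF /=.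
  by case: (black K u _ && _); rewrite ?orbT.
- case: (Ka _ _ xy) => [->|]; [by left | right].
  by rewrite (negPf xz) (negPf yz) xS yS !andbT !orbF.
Qed.

End Contract.

End Quotient.

(** * Dead hyperedges of the incidence graph and small sets hitting them *)

Section Hypergraph.

Variables (V : finType) (H : {set {set V}}).

Let T : finType := (V + hedge H)%type.
Let adj : rel T := @incidence_adj V H.

Lemma incidence_adjC : symmetric adj.
Proof. by case=> [x|e] [y|f]. Qed.

Definition alive (K : trigraph T) (phi : T -> T) (e : hedge H) :=
  [exists y, black K (phi (inr e)) (phi y)].

(** The first vertex hits every hyperedge of part [w] when [w] has a black neighbour; the second,
    taken inside [w], hits every hyperedge whose part is black to [w]. *)
Definition black_hitter (K : trigraph T) (phi : T -> T) (w : T) : {set V} :=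
  (if [pick x | black K w (phi (inl x))] is Some x then [set x] else set0)
  :|: (if [pick x | phi (inl x) == w] is Some x then [set x] else set0).

Lemma card_black_hitter K phi w : #|black_hitter K phi w| <= 2.
Proof.
apply: leq_trans (leq_card_setU _ _) _; rewrite (@leq_add _ _ 1 1) //.
  by case: pickP => *; rewrite ?cards1 ?cards0.
by case: pickP => *; rewrite ?cards1 ?cards0.
Qed.

Lemma black_hitter_alive K phi (e : hedge H) : quotient_map adj K phi ->
  alive K phi e -> ~~ [disjoint black_hitter K phi (phi (inr e)) & val e].
Proof.
case=> _ Kb _ /existsP[y ey]; rewrite /black_hitter.
have := Kb _ _ ey; case: y ey => [x|//] ex _.
case: pickP => [y ey|/(_ x)]; last by rewrite ex.
by apply/pred0Pn; exists y; rewrite /= !inE eqxx; apply: (Kb _ _ ey).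
Qed.

(** [quotient_map] does not make black edges symmetric, so both orientations are allowed. *)
Lemma black_hitter_black K phi (e : hedge H) x : quotient_map adj K phi ->
  black K (phi (inl x)) (phi (inr e)) || black K (phi (inr e)) (phi (inl x)) ->
  ~~ [disjoint black_hitter K phi (phi (inl x)) & val e].
Proof.
case=> _ Kb _ xe; rewrite /black_hitter.
case: [pick y | phi (inl y) == _] / pickP => [y /eqP yx|/(_ x)]; last by rewrite eqxx.
apply/pred0Pn; exists y; rewrite /= !inE eqxx orbT /=.
by case/orP: xe; rewrite -yx => /Kb.
Qed.

(** If the part of [e] is [u] or [v], its old black neighbour supplies the hitting vertex. Otherwise
    that neighbour must be [u] or [v], as its black edge would survive, and it contains a vertex of
    [V] because incidence is bipartite. *)
Lemma dies_in_contract K phi u v z (e : hedge H) :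
  quotient_map adj K phi -> z \notin (tV K :\ u) :\ v ->
  alive K phi e -> ~~ alive (contract K u v z) (merge u v z phi) e ->
  ~~ [disjoint black_hitter K phi u :|: black_hitter K phi v & val e].
Proof.
move=> Kphi z_new al_e dead_e.
have hit w : w = u \/ w = v -> ~~ [disjoint black_hitter K phi w & val e] ->
    ~~ [disjoint black_hitter K phi u :|: black_hitter K phi v & val e].
  by case=> ->; apply: meets_subset; rewrite (subsetUl, subsetUr).
case: (mergeP Kphi z_new (inr e)) => [[_ euv]|[De eS _ _ _]].
  by apply: hit euv _; apply: black_hitter_alive.
have /existsP[y ey] := al_e.
case: (mergeP Kphi z_new y) => [[_ yuv]|[Dy yS _ _ _]]; last first.
  by case/existsP: dead_e; exists y; rewrite De Dy black_contractE ey eS yS.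
have [_ /(_ _ _ ey) + _] := Kphi.
case: y ey yuv => // x ex xuv _; apply: hit xuv _.
by apply: black_hitter_black; rewrite // ex orbT.
Qed.

Definition red_ball (K : trigraph T) w := w |: [set y in tV K | red K w y].

Lemma card_red_ball d K w : d_trigraph d K -> w \in tV K -> #|red_ball K w| <= d.+1.
Proof.
by move=> dK Kw; apply: leq_trans (leq_card_setU _ _) _; rewrite cards1 add1n ltnS dK.
Qed.

(** For [w] the part of a dead hyperedge, [q] ranges over the possible parts of its vertices, and
    [p] over [q] and the parts red to [q]. *)
Definition red_ball_hitter K phi w :=
  \bigcup_(q in red_ball K w) \bigcup_(p in red_ball K q) black_hitter K phi p.

Lemma card_red_ball_hitter d K phi w : d_trigraph d K -> w \in tV K ->
  #|red_ball_hitter K phi w| <= d.+1 * (d.+1 * 2).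
Proof.
move=> dK Kw; apply: leq_trans (leq_mul (card_red_ball dK Kw) (leqnn _)).
apply: card_bigcup_le => q Nq.
have Kq : q \in tV K by move: Nq; rewrite !inE => /orP[/eqP->|/andP[]].
apply: leq_trans (leq_mul (card_red_ball dK Kq) (leqnn _)).
by apply: card_bigcup_le => p _; apply: card_black_hitter.
Qed.

(** Take [x] in both hyperedges. As [e] is dead, the part of [x] is that of [e] or red to it; the
    part of [f] then equals the part of [x], or is black or red to it. *)
Lemma red_ball_hitter_hits K phi (e f : hedge H) : quotient_map adj K phi ->
  ~~ alive K phi e -> alive K phi f -> ~~ [disjoint val e & val f] ->
  ~~ [disjoint red_ball_hitter K phi (phi (inr e)) & val f].
Proof.
move=> Kphi dead_e al_f /pred0Pn[x /= /andP[xe xf]].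
have [KV _ Ka] := Kphi.
have Nx : phi (inl x) \in red_ball K (phi (inr e)).
  case: (Ka (inr e) (inl x) xe) => [->|/orP[ex|ex]]; first by rewrite setU11.
    by case/existsP: dead_e; exists (inl x).
  by rewrite !inE KV ex orbT.
have hit p : p \in red_ball K (phi (inl x)) ->
    ~~ [disjoint black_hitter K phi p & val f] ->
    ~~ [disjoint red_ball_hitter K phi (phi (inr e)) & val f].
  move=> Np; apply: meets_subset.
  by apply: subset_trans (bigcup_sup _ Nx); apply: bigcup_sup Np.
case: (Ka (inl x) (inr f) xf) => [E|/orP[bxf|rxf]].
- by apply: (hit (phi (inr f))); rewrite -?E ?setU11 // E black_hitter_alive.
- by apply: (hit (phi (inl x))); rewrite ?setU11 // black_hitter_black ?bxf.
- by apply: (hit (phi (inr f))); rewrite ?black_hitter_alive // !inE KV rxf orbT.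
Qed.

(** By the last clause, a hyperedge missed by [S] is disjoint from all of [M] and can join the
    packing. *)
Definition hitting_packing (c : nat) (K : trigraph T) : Prop :=
  exists (phi : T -> T) (S : {set V}) (M : {set {set V}}),
  [/\ quotient_map adj K phi,
      (M \subset H) && pairwise_disjoint M,
      #|S| <= c * #|M|,
      forall e, ~~ alive K phi e -> ~~ [disjoint S & val e] &
      forall (e : hedge H) f, f \in M -> ~~ [disjoint f & val e] ->
        ~~ [disjoint S & val e]].

Hypothesis H_n0 : forall e, e \in H -> e != set0.

Lemma hitting_packing_init c : hitting_packing c (graph_trigraph adj).
Proof.
exists id, set0, set0; split.
- by split=> [x|x y|x y xy]; rewrite /black ?inE //; right; rewrite /tadj /black inE xy.
- by rewrite sub0set; apply/pairwise_disjointP => e f; rewrite inE.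
- by rewrite cards0.
- move=> e /negP[]; have /set0Pn[x ex] := H_n0 (valP e).
  by apply/existsP; exists (inl x); rewrite /black inE.
- by move=> e f; rewrite inE.
Qed.

Lemma hitting_packing_step d K K' : contraction_step K K' -> d_trigraph d K' ->
  hitting_packing (4 + d.+1 * (d.+1 * 2)) K ->
  hitting_packing (4 + d.+1 * (d.+1 * 2)) K'.
Proof.
move=> [u [v [z [_ _ _ z_new ->]]]] dK' [phi [S [M [Kphi MH cS deadS hitS]]]].
have K'phi := quotient_contract incidence_adjC Kphi z_new.
set K1 := contract K u v z in dK' K'phi *; set phi1 := merge u v z phi in K'phi *.
(* One new member of [M] is enough even if several hyperedges die at once: the hitters of [u] and
   [v] meet all of them. *)
case: (pickP [pred e : hedge H | ~~ alive K1 phi1 e & [disjoint S & val e]]); last first.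
  move=> noe; exists phi1, S, M; split=> // e de.
  by have /= := noe e; rewrite de /= => ->.
move=> e /= /andP[dead_e Se].
pose R := black_hitter K phi u :|: black_hitter K phi v
            :|: red_ball_hitter K1 phi1 (phi1 (inr e)).
have dis_e f : f \in M -> [disjoint f & val e].
  by move=> Mf; apply: contraLR Se => /(hitS e f Mf).
(* A member of [M] would be disjoint from itself, hence empty. *)
have eM : val e \notin M.
  apply: contraL Se => /dis_e.
  by rewrite -setI_eq0 setIid => e0; have := H_n0 (valP e); rewrite e0.
have hitSR (f : hedge H) : ~~ [disjoint S & val f] \/ ~~ [disjoint R & val f] ->
    ~~ [disjoint S :|: R & val f].
  by case; apply: meets_subset; rewrite (subsetUl, subsetUr).
have deadSR (f : hedge H) : ~~ alive K1 phi1 f -> ~~ [disjoint S :|: R & val f].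
  move=> df; apply: hitSR; case al: (alive K phi f); last first.
    by left; apply: deadS; rewrite al.
  right; apply: meets_subset (dies_in_contract Kphi z_new al df); exact: subsetUl.
exists phi1, (S :|: R), (val e |: M); split=> //.
- case/andP: MH => MH /pairwise_disjointP disM; apply/andP; split.
    by rewrite subUset MH sub1set (valP e).
  apply/pairwise_disjointP => f g /setU1P[->|Mf] /setU1P[->|Mg] //; last exact: disM.
  + by rewrite eqxx.
  + by move=> _; rewrite disjoint_sym dis_e.
  + by move=> _; rewrite dis_e.
- rewrite cardsU1 eM mulnDr muln1 addnC.
  apply: leq_trans (leq_card_setU _ _) _; rewrite leq_add //.
  have [K1V _ _] := K'phi.
  apply: leq_trans (leq_card_setU _ _) _.
  rewrite leq_add ?card_red_ball_hitter //.
  apply: leq_trans (leq_card_setU _ _) _.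
  by rewrite (@leq_add _ _ 2 2) ?card_black_hitter.
- move=> f g /setU1P[->|Mg] gf; last by apply: hitSR; left; apply: hitS gf.
  case al: (alive K1 phi1 f); last by apply: deadSR; rewrite al.
  apply: hitSR; right.
  by apply: meets_subset (red_ball_hitter_hits K'phi dead_e al gf); rewrite subsetUr.
Qed.

(** With a single part every hyperedge is dead, so [S] is a transversal. *)
Lemma hitting_packing_final c K : #|tV K| = 1 -> hitting_packing c K ->
  tau H <= c * mu H.
Proof.
move=> /eqP/cards1P[w Dw] [phi [S [M [[KV Kb _] MH cS deadS _]]]].
have Ew x : phi x = w by apply/set1P; rewrite -Dw.
apply: (@leq_trans #|S|).
  apply: bigminn_inf; apply/forall_inP => e He.
  apply: (deadS (exist _ e He)); apply/existsP => -[y].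
  (* All parts coincide, so a black neighbour would make [e] adjacent to itself. *)
  by rewrite (Ew y) -(Ew (inr (exist _ e He))) => /Kb.
apply: leq_trans cS _; rewrite leq_mul2l /mu; apply/orP; right.
exact: (@leq_bigmax_cond _ _ (fun F : {set {set V}} => #|F|) M).
Qed.

End Hypergraph.

Theorem mainTheorem19 :
  forall t : nat, exists c : nat,
    forall (V : finType) (H : {set {set V}}),
      (forall e, e \in H -> e != set0) ->
      hyp_tww_le H t ->
      tau H <= c * mu H.
Proof.
move=> t; exists (4 + t.+1 * (t.+1 * 2)) => V H H_n0 [d [dt [s [step hd s_gt0 fin deg]]]].
set G := graph_trigraph _ in step hd fin deg.
(* The sequence has width [d], possibly below [t]; the constant is monotone in the width. *)
apply: (leq_trans _ (_ : (4 + d.+1 * (d.+1 * 2)) * mu H <= _)); last first.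
  by rewrite leq_mul // leq_add2l !leq_mul.
have inv i : i < size s -> hitting_packing (4 + d.+1 * (d.+1 * 2)) (nth G s i).
  elim: i => [_|i IHi lt_i]; first by rewrite nth0 hd; apply: hitting_packing_init.
  apply: (hitting_packing_step H_n0 _ (deg _ lt_i) (IHi (ltnW lt_i))).
  by apply: step; rewrite ltn_predRL.
apply: (hitting_packing_final fin); rewrite -nth_last; apply: inv.
by rewrite prednK.
Qed.
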